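(* Let $\mathbf{Q}(t)=(Q_1(t),\ldots,Q_K(t))$, $t\in\{0,1,2,\ldots\}$, be a stochastic vector process with real-valued components and $p(t)$ a real-valued stochastic process on the same probability space. Let $\mathcal{H}(0)=\{\mathbf{Q}(0)\}$ and, for $t>0$, $\mathcal{H}(t)=\{\mathbf{Q}(0),\ldots,\mathbf{Q}(t),p(0),\ldots,p(t-1)\}$. Let $L(\mathbf{Q})=\frac{1}{2}\sum_{k=1}^K w_kQ_k^2$ with constants $w_k>0$, and $\Delta(\mathcal{H}(t))=\mathbb{E}[L(\mathbf{Q}(t+1))-L(\mathbf{Q}(t))\mid \mathcal{H}(t)]$. Suppose: (i) $\mathbb{E}[p(t)^2]<\infty$ for all $t$ and $\sum_{\tau=1}^\infty \mathbb{E}[p(\tau)^2]/\tau^2<\infty$; (ii) there is a finite constant $D>0$ with $\mathbb{E}[(Q_k(t+1)-Q_k(t))^4\mid\mathbf{Q}(t)]\leq D$ for all $t$, all possible $\mathbf{Q}(t)$ and all $k$; (iii) $\mathbb{E}[Q_k(t)^2]$ is finite for all $k,t$ and $\sum_{t=1}^\infty \mathbb{E}[Q_k(t)^2]/t^2<\infty$ for all $k\in\{1,\ldots,K\}$; (iv) there are constants $B$, $p^*$, $V\geq 0$, $\epsilon\geq 0$ such that for all $t$ and all possible $\mathcal{H}(t)$, $$\Delta(\mathcal{H}(t))+V\,\mathbb{E}[p(t)\mid\mathcal{H}(t)]\leq B+Vp^*-\epsilon\sum_{k=1}^K|Q_k(t)|.$$ Then: (a) If $V>0$, then $\limsup_{t\to\infty}\frac{1}{t}\sum_{\tau=0}^{t-1}p(\tau)\leq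 p^*+\frac{B}{V}$ with probability 1. (b) If $\epsilon>0$, then with probability 1, $$\limsup_{t\to\infty}\frac{1}{t}\sum_{\tau=0}^{t-1}\sum_{k=1}^K|Q_k(\tau)|\leq\frac{B}{\epsilon}+\frac{V}{\epsilon}\limsup_{t\to\infty}\frac{1}{t}\sum_{\tau=0}^{t-1}[p^*-p(\tau)].$$
   Context: Time is slotted. ''For all possible $\mathcal{H}(t)$'' (resp. $\mathbf{Q}(t)$) means for every realization (almost surely). *)

(* Defs.v *)
From HB Require Import structures.
From mathcomp Require Import all_boot all_order all_algebra.
From mathcomp Require Import all_classical all_reals all_analysis.
Set Implicit Arguments. Unset Strict Implicit. Unset Printing Implicit Defensive.
Import Order.TTheory GRing.Theory Num.Theory.
Local Open Scope classical_set_scope.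
Local Open Scope ring_scope.

Section Defs.
Context {d : measure_display} {T : measurableType d} {R : realType}.

Definition sigma_gen (fs : set (T -> R)) : set (set T) :=
  <<s [set A | exists f, exists B : set R,
         [/\ fs f, measurable B & A = f @^-1` B]] >>.

Definition G_measurable (G : set (set T)) (Y : T -> R) : Prop :=
  forall B : set R, measurable B -> G (Y @^-1` B).

Definition cond_exp_version (P : probability T R) (G : set (set T))
  (X Y : T -> R) : Prop :=
  G_measurable G Y /\
  (forall A, G A -> (\int[P]_(x in A) (X x)%:E = \int[P]_(x in A) (Y x)%:E)%E).

Definition Hsigma (K : nat) (Q : nat -> 'I_K -> T -> R) (p : nat -> T -> R)
  (t : nat) : set (set T) :=
  sigma_gen [set f | (exists k s, (s <= t)%N /\ f = Q s k) \/
                     (exists s, (s < t)%N /\ f = p s)].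

Definition Qsigma (K : nat) (Q : nat -> 'I_K -> T -> R) (t : nat) : set (set T) :=
  sigma_gen [set f | exists k, f = Q t k].

End Defs.

Definition lyap {R : realType} (K : nat) (w : 'I_K -> R) (q : 'I_K -> R) : R :=
  2^-1 * \sum_(k < K) w k * q k ^+ 2.

Definition tavg {R : realType} (f : nat -> R) (t : nat) : R :=
  t%:R^-1 * \sum_(tau < t) f tau.

(* Main.v *)
(* Put [M t = Delta L (t) + V p t + eps * sum_k |Q_k t| - (B + V p^* )], where
   [Delta L] is the realized drift, so that (iv) says [E(M t | H t) <= 0].
   Conditions (i)-(iii) give [sum_t E(M t ^ 2) / (t + 1) ^ 2 < oo].
   A one-sided Hajek-Renyi inequality then bounds the probability that the sum
   of [M] over a window [m, n[ ever exceeds [e * (n + 1)] by [e ^ -2] times the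
   tail of this series from [m] on, so a.s. the averages of [M] have limsup at
   most [0].  The drifts telescope to [L (Q n) - L (Q 0) >= - L (Q 0)], which
   disappears after division by [n]; what remains is (a) and (b).  Conditional
   expectations are only used through [E(M t 1_A) <= 0] for [A] in [H t],
   extended to bounded nonnegative [H t]-measurable weights. *)

Require Import Defs.
From HB Require Import structures.
From mathcomp Require Import all_boot all_order all_algebra.
From mathcomp Require Import all_classical all_reals all_analysis.
From mathcomp Require Import measurable_realfun ring lra.
Import Order.TTheory GRing.Theory Num.Theory.
Import numFieldNormedType.Exports.
Set Implicit Arguments. Unset Strict Implicit. Unset Printing Implicit Defensive.
Local Open Scope classical_set_scope.
Local Open Scope ring_scope.

(** * Conditional inequalities tested against weights measurable for a generated sigma-algebra *)

Section CondExp.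
Context (d : measure_display) (T : measurableType d) (R : realType).
Context (P : probability T R) (C : set (set T)).
Hypothesis mC : C `<=` measurable.
Implicit Types (f g X Y M : T -> R) (A : set T).

Lemma sub_sigma A : <<s C >> A -> measurable A.
Proof. by move=> CA; apply: (smallest_sub _ mC) CA; exact: sigma_algebra_measurable. Qed.

(** Moves to the type carrying the generated sigma-algebra, where the closure properties of
    measurable functions apply. *)
Lemma G_measurableP f : G_measurable <<s C >> f <->
  measurable_fun [set: g_sigma_algebraType C] (f : g_sigma_algebraType C -> R).
Proof.
split=> [mf _ B mB|mf B mB]; first by rewrite setTI; exact: mf.
by rewrite -(setTI (f @^-1` B)); exact: mf.
Qed.

Lemma G_measurable_sub f : G_measurable <<s C >> f -> measurable_fun setT f.
Proof. by move=> mf _ B mB; rewrite setTI; apply: sub_sigma; exact: mf. Qed.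

Lemma integrableMb g M (c : R) : P.-integrable setT (EFin \o M) ->
  measurable_fun setT g -> (forall x, `|g x| <= c) ->
  P.-integrable setT (EFin \o (fun x => g x * M x)).
Proof.
move=> iM mg gc.
apply: (@le_integrable _ _ _ P setT _ _ (fun x => c%:E * (EFin \o M) x)%E) => //.
- apply/measurable_EFinP; apply: measurable_funM => //.
  by apply/measurable_EFinP; exact: measurable_int iM.
- move=> x _ /=; rewrite lee_fin !normrM ler_wpM2r// (le_trans (gc x))// ler_norm//.
- exact: integrableZl.
Qed.

(* Peeling off the first binary digit of [g] halves the worst case. *)
Lemma Rintegral_mul_le0 g M : P.-integrable setT (EFin \o M) ->
  (forall A, <<s C >> A -> \int[P]_(x in A) M x <= 0) ->
  G_measurable <<s C >> g -> (forall x, 0 <= g x <= 1) ->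
  \int[P]_x (g x * M x) <= 0.
Proof.
move=> iM M0.
have H n : forall g, G_measurable <<s C >> g -> (forall x, 0 <= g x <= 1) ->
    \int[P]_x (g x * M x) <= 2^-1 ^+ n * \int[P]_x `|M x|.
  elim: n => [|n IH] {}g mg g01.
    rewrite expr0 mul1r; apply: le_Rintegral => //.
    - apply: (@integrableMb _ _ 1) => //; first exact: G_measurable_sub mg.
      by move=> x; have /andP[? ?] := g01 x; rewrite ger0_norm.
    - exact: integrable_norm.
    - move=> x _; apply: (le_trans (ler_norm _)); rewrite normrM.
      have /andP[? ?] := g01 x.
      by rewrite ger0_norm// ler_piMl.
  pose A := [set x | 2^-1 <= g x].
  have CA : <<s C >> A.
    rewrite (_ : A = g @^-1` `[2^-1, +oo[%classic); first exact: mg.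
    by apply/seteqP; split=> x /=; rewrite in_itv/= andbT.
  (* The remaining binary digits of [g], shifted: [g = (1_A + g') / 2] with [g'] again valued in
     [0, 1]. The [1_A] half contributes at most 0 by hypothesis, the other half falls to the
     induction. *)
  pose g' x := 2 * g x - \1_A x.
  have mA := sub_sigma CA.
  have mg' : G_measurable <<s C >> g'.
    apply/G_measurableP; apply: measurable_funB.
      by apply: measurable_funM => //; exact/G_measurableP.
    exact: (@measurable_indic _ (g_sigma_algebraType C)).
  have g'01 x : 0 <= g' x <= 1.
    have /andP[? ?] := g01 x.
    rewrite /g' indicE; have [/set_mem|/negP xA] := boolP (x \in A).
      by rewrite /A/= => ?; rewrite mulr1n; lra.
    have : ~ (2^-1 <= g x) by move=> h; apply: xA; rewrite inE.
    by move/negP; rewrite -ltNge mulr0n => ?; lra.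
  have -> : \int[P]_x (g x * M x) =
      2^-1 * (\int[P]_x (\1_A x * M x) + \int[P]_x (g' x * M x)).
    have i1 : P.-integrable setT (EFin \o (fun x => \1_A x * M x)).
      apply: (@integrableMb _ _ 1) => //.
      by move=> x; rewrite indicE; case: (x \in A); rewrite ?normr1 ?normr0.
    have i2 : P.-integrable setT (EFin \o (fun x => g' x * M x)).
      apply: (@integrableMb _ _ 1) => //; first exact: G_measurable_sub mg'.
      by move=> x; have /andP[? ?] := g'01 x; rewrite ger0_norm.
    rewrite -RintegralD// -RintegralZl//; last first.
      exact: (@integrableD _ _ _ P setT measurableT _ _ i1 i2).
    by apply: eq_Rintegral => x _; rewrite /g'; field.
  have : \int[P]_x (\1_A x * M x) <= 0.
    have := M0 _ CA; rewrite Rintegral_mkcond.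
    congr (_ <= _); apply: eq_Rintegral => x _.
    by rewrite patchE indicE; case: ifPn => _; rewrite ?mul1r ?mul0r.
  have := IH _ mg' g'01; rewrite exprS -mulrA.
  by set a := \int[P]_x _; set b := \int[P]_x _; set c := _ * _; lra.
move=> mg g01; set E := \int[P]_x `|M x|.
have E0 : 0 <= E by apply: Rintegral_ge0.
have cv : (fun n => 2^-1 ^+ n * E) @ \oo --> (0 : R).
  rewrite -[0](mul0r E); apply: cvgMl.
  by apply: cvg_expr; rewrite ger0_norm ?invr_ge0// invf_lt1 ?ltr1n.
rewrite -(cvg_lim _ cv)//.
by apply: limr_ge; [apply: cvgP cv|apply: nearW => n; exact: H].
Qed.

(** Discarding the negative part of [Y] can only raise the integral, and the positive part is a.e.
    at most [D] because [0 <= D]. *)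
Lemma ae_integral_le_cst Y (D : R) A : 0 <= D -> measurable A ->
  measurable_fun setT Y -> {ae P, forall x, Y x <= D} ->
  (\int[P]_(x in A) (Y x)%:E <= D%:E * P A)%E.
Proof.
move=> D0 mA mY YD; rewrite integralE.
have mY' : measurable_fun A (EFin \o Y).
  by apply/measurable_EFinP; exact: measurable_funTS.
apply: (@le_trans _ _ (\int[P]_(x in A) ((EFin \o Y)^\+ x))%E).
  by rewrite -[leRHS]sube0 leeB// integral_ge0.
rewrite -integral_cst//; apply: ae_ge0_le_integral => //.
- exact: measurable_funepos.
- by move: YD; apply: filterS => x YD _; rewrite funeposE/= ge_max !lee_fin YD.
Qed.

Lemma cond_exp_version_le X Y (D : R) A : 0 <= D ->
  cond_exp_version P <<s C >> X Y -> {ae P, forall x, Y x <= D} ->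
  <<s C >> A -> (\int[P]_(x in A) (X x)%:E <= D%:E * P A)%E.
Proof.
move=> D0 [mY XY] YD CA; rewrite XY//; apply: ae_integral_le_cst => //.
  exact: sub_sigma.
exact: G_measurable_sub.
Qed.

(** The definition of a version does not include integrability. The set where [Y >= 0] and its
    complement lie in the sigma-algebra, so the integral of [|Y|] on each is, up to sign, that of
    [X], hence finite. *)
Lemma cond_exp_version_integrable X Y : P.-integrable setT (EFin \o X) ->
  cond_exp_version P <<s C >> X Y -> P.-integrable setT (EFin \o Y).
Proof.
move=> iX [mY XY]; have mY' := G_measurable_sub mY.
pose A := Y @^-1` `[0, +oo[%classic.
have CA : <<s C >> A by exact: mY.
have CA' : <<s C >> (~` A) by rewrite /A preimage_setC; apply: mY; exact: measurableC.
have mA := sub_sigma CA; have mA' := sub_sigma CA'.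
have A0 x : A x -> 0 <= Y x by rewrite /A/= in_itv/= andbT.
have A'0 x : (~` A) x -> Y x <= 0.
  by rewrite /A/= in_itv/= andbT => /negP; rewrite -ltNge => /ltW.
have fX B : measurable B -> (\int[P]_(x in B) (X x)%:E)%E \is a fin_num.
  by move=> mB; apply: integrable_fin_num => //; exact: integrableS iX.
apply/integrableP; split; first exact/measurable_EFinP.
rewrite -(setUv A) ge0_integral_setU//; last 2 first.
- by rewrite setUv; apply/measurable_EFinP; exact: measurableT_comp.
- by apply/disj_setPS => x [].
apply: lte_add_pinfty.
  rewrite (@eq_integral _ _ _ _ A (EFin \o Y)).
    by have := fX _ mA; rewrite XY// ltey_eq => ->.
  by move=> x /set_mem/A0 ?; rewrite /= ger0_norm.
have : ((- \int[P]_(x in ~` A) `|(EFin \o Y) x|)%E \is a fin_num).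
  rewrite -integral_ge0N// (_ : (\int[P]_(x in ~` A) _)%E = (\int[P]_(x in ~` A) (X x)%:E)%E) ?fX//.
  rewrite XY//; apply: eq_integral => x /set_mem/A'0 ?.
  by rewrite /= ler0_norm// opprK.
by rewrite fin_numN ltey_eq => ->.
Qed.

(** Needed for the unbounded weight [Q^2]. Truncations of [f], rescaled to [0, 1], are tested
    against [X - D]; monotone convergence then removes the truncation. *)
Lemma ge0_integral_mul_le X f (D : R) : measurable_fun setT X ->
  (forall x, 0 <= X x) -> 0 <= D ->
  (forall A, <<s C >> A -> (\int[P]_(x in A) (X x)%:E <= D%:E * P A)%E) ->
  G_measurable <<s C >> f -> (forall x, 0 <= f x) ->
  (\int[P]_x (f x * X x)%:E <= D%:E * \int[P]_x (f x)%:E)%E.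
Proof.
move=> mX X0 D0 XD mf f0; have mf' := G_measurable_sub mf.
have iX : P.-integrable setT (EFin \o X).
  apply/integrableP; split; first exact/measurable_EFinP.
  under eq_integral do rewrite /= ger0_norm//.
  apply: (le_lt_trans (XD setT _)); last by rewrite probability_setT mule1 ltry.
  exact: (@measurableT _ (g_sigma_algebraType C)).
have iXD : P.-integrable setT (EFin \o (fun x => X x - D)).
  by apply: (@integrableB _ _ _ P setT measurableT (EFin \o X) (cst D%:E)) => //; exact: finite_measure_integrable_cst.
have XD0 A : <<s C >> A -> \int[P]_(x in A) (X x - D) <= 0.
  move=> CA; have mA := sub_sigma CA.
  rewrite RintegralB//; [|exact: integrableS iX|exact: finite_measure_integrable_cst].
  rewrite Rintegral_cst// subr_le0 -lee_fin EFinM (fineK (fin_num_measure _ _ _))//.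
  rewrite fineK; first exact: XD.
  by apply: integrable_fin_num => //; exact: integrableS iX.
(* The level is [N.+1] rather than [N] so that one can divide by it. *)
pose fN (N : nat) x := Num.min (f x) N.+1%:R.
have fN0 N x : 0 <= fN N x by rewrite le_min f0/=.
have fNN N x : fN N x <= N.+1%:R by rewrite ge_min lexx orbT.
have mfN N : G_measurable <<s C >> (fN N).
  apply/G_measurableP; apply: measurable_minr => //.
  exact/G_measurableP.
have fNX N : (\int[P]_x (fN N x * X x)%:E <= D%:E * \int[P]_x (f x)%:E)%E.
  have mfN' := G_measurable_sub (mfN N).
  have ifN : P.-integrable setT (EFin \o fN N).
    rewrite (_ : fN N = fun x => fN N x * cst 1 x); last first.
      by apply/funext => x; rewrite mulr1.
    apply: (integrableMb (c := N.+1%:R)) => //.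
      exact: finite_measure_integrable_cst.
    by move=> x; rewrite ger0_norm.
  have ifX : P.-integrable setT (EFin \o (fun x => fN N x * X x)).
    by apply: (integrableMb (c := N.+1%:R)) => // x; rewrite ger0_norm.
  apply: (@le_trans _ _ (D%:E * \int[P]_x (fN N x)%:E)%E); last first.
    rewrite lee_wpmul2l ?lee_fin// ge0_le_integral//.
    - by move=> x _; rewrite lee_fin.
    - exact/measurable_EFinP.
    - exact/measurable_EFinP.
    - by move=> x _; rewrite lee_fin ge_min lexx.
  rewrite -(fineK (integrable_fin_num _ ifX))// -(fineK (integrable_fin_num _ ifN))//.
  rewrite -EFinM lee_fin -RintegralZl// -subr_le0 -RintegralB//; last first.
    exact: (@integrableZl _ _ _ P setT measurableT D _ ifN).
  have -> : \int[P]_x (fN N x * X x - D * fN N x) =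
      N.+1%:R * \int[P]_x (N.+1%:R^-1 * fN N x * (X x - D)).
    rewrite -RintegralZl//; last first.
      apply: (integrableMb (c := 1)) => //; first exact: measurable_funM.
      by move=> x; rewrite ger0_norm ?mulr_ge0// mulrC ler_pdivrMr// mul1r.
    by apply: eq_Rintegral => x _; rewrite -mulrA mulVKf ?pnatr_eq0//; ring.
  rewrite pmulr_rle0//; apply: Rintegral_mul_le0 => //.
    by apply/G_measurableP; apply: measurable_funM => //; exact/G_measurableP.
  by move=> x; rewrite mulr_ge0//= mulrC ler_pdivrMr// mul1r.
have cv x : (fN N x * X x)%:E @[N --> \oo] --> (f x * X x)%:E.
  apply: cvg_near_cst; exists (Num.truncn (f x)) => // N /= ltN.
  rewrite /fN min_l//; apply: (le_trans (ltW (truncnS_gt (f x)))).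
  by rewrite ler_nat.
rewrite (eq_integral (fun x => limn (fun N => (fN N x * X x)%:E))); last first.
  by move=> x _; apply/esym/cvg_lim => //; exact: cv.
rewrite (monotone_convergence P measurableT (g' := fun N x => (fN N x * X x)%:E))//.
- apply: lime_le; last by apply: nearW.
  apply: ereal_nondecreasing_is_cvgn => m n mn; apply: ge0_le_integral => //.
  + by move=> x _; rewrite lee_fin mulr_ge0.
  + by apply/measurable_EFinP; apply: measurable_funM => //; exact: G_measurable_sub (mfN _).
  + by apply/measurable_EFinP; apply: measurable_funM => //; exact: G_measurable_sub (mfN _).
  + move=> x _; rewrite lee_fin ler_wpM2r// le_min ge_min lexx/=.
    by rewrite ge_min ler_nat ltnS mn orbT.
- by move=> n; apply/measurable_EFinP; apply: measurable_funM => //; exact: G_measurable_sub (mfN _).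
- by move=> n x _; rewrite lee_fin mulr_ge0.
- move=> x _ m n mn; rewrite lee_fin ler_wpM2r// le_min ge_min lexx/=.
  by rewrite ge_min ler_nat ltnS mn orbT.
Qed.

End CondExp.

(** * Square-summable sequences and their moments *)

Definition L2_summable (d : measure_display) (T : measurableType d) (R : realType)
    (P : probability T R) (X : nat -> T -> R) :=
  (forall t, measurable_fun setT (X t)) /\
  (\sum_(0 <= t <oo)
     ((\int[P]_x ((X t x) ^+ 2)%:E) * ((t.+1%:R ^+ 2)^-1)%:E) < +oo)%E.

Section StrongLaw.
Context (d : measure_display) (T : measurableType d) (R : realType).
Context (P : probability T R).

Lemma bounded_integrable (f : T -> R) (c : R) : measurable_fun setT f ->
  (forall x, `|f x| <= c) -> P.-integrable setT (EFin \o f).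
Proof.
move=> mf fc; rewrite (_ : f = fun x => f x * cst 1 x); last first.
  by apply/funext => x; rewrite mulr1.
by apply: (integrableMb (c := c)) => //; exact: finite_measure_integrable_cst.
Qed.

(** Each weight [1/(t+1)^2] is positive, also at [t = 0], so a single infinite second moment would
    make the whole series infinite. *)
Lemma L2_summable_integrable_sqr (X : nat -> T -> R) t :
  L2_summable P X -> P.-integrable setT (EFin \o (fun x => X t x ^+ 2)).
Proof.
move=> [mX Xoo]; apply/integrableP; split.
  by apply/measurable_EFinP; exact: measurable_funX.
under eq_integral do rewrite /= ger0_norm ?sqr_ge0//.
have I0 s : (0 <= \int[P]_x ((X s x) ^+ 2)%:E)%E.
  by apply: integral_ge0 => x _; rewrite lee_fin sqr_ge0.
rewrite ltNge leye_eq; apply/negP => /eqP XE.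
move: Xoo; rewrite (nneseries_pinfty _ (k := t))// ?XE.
  by move=> s _; rewrite mule_ge0// lee_fin invr_ge0 sqr_ge0.
by rewrite gt0_mulye// lte_fin invr_gt0 exprn_gt0.
Qed.

(** Follows from [|X| <= 1 + X^2], itself a consequence of [(|X| - 1)^2 >= 0]. *)
Lemma L2_summable_integrable (X : nat -> T -> R) t :
  L2_summable P X -> P.-integrable setT (EFin \o X t).
Proof.
move=> X2; have iX := L2_summable_integrable_sqr t X2.
have i1 : P.-integrable setT (EFin \o cst (1 : R)) by exact: finite_measure_integrable_cst.
apply: le_integrable (integrableD _ i1 iX) => //.
- by apply/measurable_EFinP; exact: X2.1.
- move=> x _ /=; rewrite lee_fin [leRHS]ger0_norm ?addr_ge0 ?sqr_ge0//.
  have := sqr_ge0 (`|X t x| - 1); rewrite sqrrB1 -(real_normK (num_real (X t x))).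
  have := normr_ge0 (X t x); have := sqr_ge0 (`|X t x|); lra.
Qed.

(** * A one-sided maximal inequality for adapted sequences with nonpositive conditional means *)

Section Maximal.
Context (C : nat -> set (set T)) (M : nat -> T -> R).
Hypothesis mC : forall t, C t `<=` measurable.
Hypothesis M2 : L2_summable P M.
Hypothesis adaptedM : forall s t, (s < t)%N -> G_measurable <<s C t >> (M s).
Hypothesis M0 : forall t A, <<s C t >> A -> \int[P]_(x in A) M t x <= 0.

Section Window.
Context (m : nat) (e : R).
Hypothesis e0 : 0 < e.

Let S k x := \sum_(s < k) M (m + s)%N x.
(** The barrier [e * N k] grows with absolute time [m + k + 1], not with time in the window, so that
    [N s] matches the weight of [M (m + s)] in the series. *)
Let N k : R := (m + k).+1%:R.
Let A k := [set x | forall j, (j < k)%N -> S j.+1 x < e * N j.+1].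
Let a k : T -> R := \1_(A k).
Let W k x := (Num.max (S k x) 0 / N k) ^+ 2.
(** Potential of the stopped path: the scaled square of the positive part while the path is below
    the barrier, frozen at [e^2] once it has crossed. It starts at 0 and equals [e^2] off [A k], so
    its mean controls the crossing probability. *)
Let Phi k x := a k x * W k x + e ^+ 2 * (1 - a k x).

Let N_gt0 k : 0 < N k. Proof. by rewrite ltr0n. Qed.

Let N_ge0 k : 0 <= N k. Proof. exact: ltW. Qed.

Let e_ge0 : 0 <= e. Proof. exact: ltW. Qed.

Let GS k j : (j <= k)%N -> G_measurable <<s C (m + k)%N >> (S j).
Proof.
move=> jk; apply/G_measurableP.
apply: (@measurable_sum _ (g_sigma_algebraType (C (m + k)%N))) => i.
suff Gi : G_measurable <<s C (m + k)%N >> (M (m + i)%N) by exact/G_measurableP.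
by apply: adaptedM; rewrite ltn_add2l (leq_trans (ltn_ord i)).
Qed.

Let AS k : A k.+1 = A k `&` [set x | S k.+1 x < e * N k.+1].
Proof.
apply/seteqP; split=> [x H|x [H H'] j].
  by split=> [j jk|]; apply: H => //; exact: ltnW.
by rewrite ltnS leq_eqVlt => /predU1P[->//|]; exact: H.
Qed.

Let GA k : <<s C (m + k)%N >> (A k).
Proof.
rewrite (_ : A k = \bigcap_(j in [set j | (j < k)%N]) (S j.+1 @^-1` `]-oo, e * N j.+1[%classic)).
  apply: (@bigcap_measurableType _ (g_sigma_algebraType (C (m + k)%N))) => // j jk.
  by apply: GS.
by apply/seteqP; split=> x H j jk; have := H j jk; rewrite /= in_itv.
Qed.

Let mA k : measurable (A k). Proof. exact: (sub_sigma (@mC (m + k)%N) (@GA k)). Qed.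

Let mS k : measurable_fun setT (S k).
Proof. by apply: (G_measurable_sub (@mC (m + k)%N)); exact: GS. Qed.

Let a01 k x : a k x = 0 \/ a k x = 1 /\ S k x <= e * N k.
Proof.
rewrite /a indicE; have [/set_mem xA|] := boolP (x \in A k); last by left.
(* [A 0] imposes no constraint; there the bound comes from [S 0 = 0]. *)
right; split => //; case: k xA => [|k] xA; last by apply: ltW; exact: xA.
by rewrite /S big_ord0 mulr_ge0.
Qed.

Let W_ge0 k x : 0 <= W k x. Proof. exact: sqr_ge0. Qed.

Let Phi_bnd k x : 0 <= Phi k x <= e ^+ 2.
Proof.
rewrite /Phi; have [->|[-> Se]] := a01 k x.
  by rewrite mul0r add0r subr0 mulr1 sqr_ge0/=.
rewrite mul1r subrr mulr0 addr0 W_ge0/= /W lerXn2r ?nnegrE ?divr_ge0 ?le_max ?lexx ?orbT//.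
by rewrite ler_pdivrMr// ge_max Se/= mulr_ge0.
Qed.

Let Phi0 x : Phi 0 x = 0.
Proof.
rewrite /Phi /W /a indicE mem_set//= /S big_ord0 maxxx mul0r expr0n/=.
by rewrite mulr0 subrr mulr0 addr0.
Qed.

(* Either the path has stayed below the barrier, and [W] grows by at most the
   increment of [(S^+)^2], or it crosses now, and then [W] is at least [e^2]. *)
Let Phi_step k x : Phi k.+1 x <= Phi k x +
  (2 * (a k x * Num.max (S k x) 0 * M (m + k)%N x) + M (m + k)%N x ^+ 2) / N k.+1 ^+ 2.
Proof.
have Sk : S k.+1 x = S k x + M (m + k)%N x by rewrite /S big_ord_recr.
have aS : a k.+1 x = a k x * (S k.+1 x < e * N k.+1)%R%:R.
  by rewrite /a AS indicI /= !indicE; congr (_ * (nat_of_bool _)%:R); apply/idP/idP; rewrite inE.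
set mu := M _ x in Sk *.
have [a0|[a1 Se]] := a01 k x.
  by rewrite /Phi aS a0 !mul0r mulr0 !add0r lerDl mulr_ge0// ?sqr_ge0// invr_ge0 sqr_ge0.
(* The square of the positive part of [S k x + mu] is at most [(s + mu)^2], which is expanded; only
   the term [s^2] gets the smaller denominator [N k ^ 2]. *)
have WN : W k.+1 x <= W k x + (2 * (Num.max (S k x) 0 * mu) + mu ^+ 2) / N k.+1 ^+ 2.
  rewrite /W; set s := Num.max (S k x) 0.
  have s0 : 0 <= s by rewrite le_max lexx orbT.
  apply: (@le_trans _ _ ((s / N k.+1) ^+ 2 + (2 * (s * mu) + mu ^+ 2) / N k.+1 ^+ 2)).
    rewrite !expr_div_n -mulrDl ler_wpM2r ?invr_ge0 ?sqr_ge0//.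
    have -> : s ^+ 2 + (2 * (s * mu) + mu ^+ 2) = (s + mu) ^+ 2 by ring.
    rewrite Sk; have [h|h] := leP (S k x + mu) 0; first by rewrite expr0n sqr_ge0.
    have Ss : S k x + mu <= s + mu by rewrite lerD2r le_max lexx.
    by rewrite lerXn2r// nnegrE ?(le_trans (ltW h))// ltW.
  rewrite lerD2r lerXn2r ?nnegrE ?divr_ge0//.
  by rewrite ler_wpM2l// lef_pV2 ?posrE// ler_nat ltnS addnS.
apply: (@le_trans _ _ (W k.+1 x)); last by rewrite /Phi a1 subrr mulr0 addr0 !mul1r.
rewrite /Phi aS a1 mul1r; case: ltP => h.
  by rewrite mul1r subrr mulr0 addr0.
rewrite mul0r add0r subr0 mulr1 /W lerXn2r ?nnegrE ?divr_ge0 ?le_max ?lexx ?orbT//.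
by rewrite ler_pdivlMr// le_max h.
Qed.

Let mPhi k : measurable_fun setT (Phi k).
Proof.
have ma : measurable_fun setT (a k) by apply: measurable_indic.
apply: measurable_funD; apply: measurable_funM => //.
  apply: measurable_funX; apply: measurable_funM => //.
  exact: measurable_maxr.
exact: measurable_funB.
Qed.

Let iPhi k : P.-integrable setT (EFin \o Phi k).
Proof.
apply: (bounded_integrable (c := e ^+ 2)) => // x.
by have /andP[? ?] := Phi_bnd k x; rewrite ger0_norm.
Qed.

(** The factor of [M (m + k)] in the cross term is nonnegative, at most [e * N k], and known at time
    [m + k]. The cross term thus has nonpositive mean, and only the squares accumulate. *)
Let EPhi k : \int[P]_x Phi k x <=
  \sum_(s < k) (\int[P]_x (M (m + s)%N x ^+ 2)) / (m + s).+1%:R ^+ 2.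
Proof.
elim: k => [|k IH].
  by rewrite big_ord0 (_ : Phi 0 = cst 0) ?Rintegral_cst ?mul0r//; apply/funext.
rewrite big_ord_recr/=; apply: le_trans (lerD IH (lexx _)).
pose g x := a k x * Num.max (S k x) 0.
have g0 x : 0 <= g x <= e * N k.
  rewrite /g; have [->|[-> Se]] := a01 k x; first by rewrite mul0r lexx mulr_ge0.
  by rewrite mul1r le_max lexx orbT/= ge_max Se mulr_ge0.
have Gg : G_measurable <<s C (m + k)%N >> g.
  apply/G_measurableP; apply: measurable_funM.
    apply: (@measurable_indic _ (g_sigma_algebraType (C (m + k)%N))) => //.
    exact: (@GA k).
  apply: measurable_maxr => //.
  by have /G_measurableP := @GS k k (leqnn k).
have iM := L2_summable_integrable (m + k) M2.
have iM2 := L2_summable_integrable_sqr (m + k) M2.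
have igM : P.-integrable setT (EFin \o (fun x => g x * M (m + k)%N x)).
  apply: (integrableMb (c := e * N k)) => //; first exact: (G_measurable_sub (@mC (m + k)%N) Gg).
  by move=> x; have /andP[? ?] := g0 x; rewrite ger0_norm.
have gM0 : \int[P]_x (g x * M (m + k)%N x) <= 0.
  have eN : 0 < e * N k by rewrite mulr_gt0.
  (* Normalising by [e * N k] brings the weight into [0, 1]. *)
  rewrite (_ : \int[P]_x _ = e * N k * \int[P]_x ((e * N k)^-1 * g x * M (m + k)%N x)).
    rewrite pmulr_rle0//; apply: (Rintegral_mul_le0 (@mC (m + k)%N)) => //.
    - by move=> B; exact: M0.
    - by apply/G_measurableP; apply: measurable_funM => //; exact/G_measurableP.
    - move=> x; have /andP[? ?] := g0 x.
      by rewrite mulr_ge0 ?invr_ge0 ?(ltW eN)//= mulrC ler_pdivrMr// mul1r.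
  under [in RHS]eq_Rintegral do rewrite -mulrA.
  by rewrite RintegralZl// mulrA mulfV ?mul1r// gt_eqF.
have i1 : P.-integrable setT (EFin \o (fun x => 2 * (g x * M (m + k)%N x))).
  exact: (@integrableZl _ _ _ P setT measurableT 2 _ igM).
have i2 : P.-integrable setT (EFin \o (fun x =>
    (2 * (g x * M (m + k)%N x) + M (m + k)%N x ^+ 2))).
  exact: (@integrableD _ _ _ P setT measurableT _ _ i1 iM2).
have i3 : P.-integrable setT (EFin \o (fun x => (N k.+1 ^+ 2)^-1 *
    (2 * (g x * M (m + k)%N x) + M (m + k)%N x ^+ 2))).
  exact: (@integrableZl _ _ _ P setT measurableT _ _ i2).
apply: (@le_trans _ _ (\int[P]_x (Phi k x + (N k.+1 ^+ 2)^-1 *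
    (2 * (g x * M (m + k)%N x) + M (m + k)%N x ^+ 2)))).
  apply: le_Rintegral => //.
    exact: (@integrableD _ _ _ P setT measurableT _ _ (iPhi k) i3).
  by move=> x _; rewrite [X in _ + X]mulrC; exact: Phi_step.
rewrite (RintegralD measurableT (iPhi k) i3) (RintegralZl _ measurableT i2).
rewrite (RintegralD measurableT i1 iM2) (RintegralZl _ measurableT igM) lerD2l mulrC.
have E0 : 0 <= \int[P]_x (M (m + k)%N x ^+ 2) by apply: Rintegral_ge0 => x _; exact: sqr_ge0.
apply: (@le_trans _ _ ((\int[P]_x (M (m + k)%N x ^+ 2)) / N k.+1 ^+ 2)).
  rewrite ler_wpM2r ?invr_ge0 ?sqr_ge0// gerDr.
  by rewrite pmulr_rle0.
(* [N k.+1] is lowered to [N k = (m + k).+1] to match the weights of the series. *)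
rewrite ler_wpM2l// lef_pV2 ?posrE ?exprn_gt0//.
by rewrite lerXn2r ?nnegrE// ler_nat ltnS addnS.
Qed.

(** Markov's inequality for [Phi k], which is [e^2] on the complement of [A k]; the finite sum over
    the window is then bounded by the tail of the series. *)
Let PA k : ((e ^+ 2)%:E * P (~` A k) <= \sum_(m <= t <oo)
  ((\int[P]_x ((M t x) ^+ 2)%:E) * ((t.+1%:R ^+ 2)^-1)%:E))%E.
Proof.
have I0 t : (0 <= (\int[P]_x ((M t x) ^+ 2)%:E) * ((t.+1%:R ^+ 2)^-1)%:E)%E.
  rewrite mule_ge0 ?lee_fin ?invr_ge0 ?sqr_ge0//.
  by apply: integral_ge0 => x _; rewrite lee_fin sqr_ge0.
apply: (@le_trans _ _ (\sum_(m <= t < m + k)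
  ((\int[P]_x ((M t x) ^+ 2)%:E) * ((t.+1%:R ^+ 2)^-1)%:E)))%E; last first.
  exact: nneseries_lim_ge.
rewrite -{1}[m]add0n big_addn addKn big_mkord.
have -> : (\sum_(i < k) ((\int[P]_x ((M (i + m)%N x) ^+ 2)%:E) *
      (((i + m).+1%:R ^+ 2)^-1)%:E) =
    (\sum_(s < k) (\int[P]_x (M (m + s)%N x ^+ 2)) / (m + s).+1%:R ^+ 2)%:E)%E.
  rewrite -sumEFin; apply: eq_bigr => i _; rewrite EFinM [(i + m)%N]addnC fineK//.
  by apply: integrable_fin_num => //; exact: L2_summable_integrable_sqr.
apply: le_trans (_ : (\int[P]_x Phi k x)%:E <= _)%E; last by rewrite lee_fin.
rewrite fineK; last exact: (integrable_fin_num measurableT (iPhi k)).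
rewrite -integral_cst; last exact: measurableC.
rewrite integral_mkcond; apply: ge0_le_integral => //.
- by move=> x _; rewrite patchE; case: ifPn => //; rewrite lee_fin sqr_ge0.
- apply/(measurable_restrictT _ _).1; first exact: measurableC.
  exact: measurable_cst.
- exact/measurable_EFinP.
move=> x _; rewrite patchE; have /andP[h _] := Phi_bnd k x.
case: ifPn => [/set_mem xA|_]; rewrite lee_fin//.
by rewrite /Phi /a indicE memNset// mul0r add0r subr0 mulr1.
Qed.

Lemma drift_maximal_inequality :
  ((e ^+ 2)%:E * P (~` [set x | forall k,
      (\sum_(s < k) M (m + s)%N x < e * (m + k).+1%:R)%R])
   <= \sum_(m <= t <oo) ((\int[P]_x ((M t x) ^+ 2)%:E) * ((t.+1%:R ^+ 2)^-1)%:E))%E.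
Proof.
have -> : ~` [set x | forall k, \sum_(s < k) M (m + s)%N x < e * (m + k).+1%:R] =
    \bigcup_k ~` A k.
  rewrite -setC_bigcap; congr (~` _); apply/seteqP; split=> x /= H.
    by move=> k _ j _; exact: H.
  case=> [|k]; last by apply: (H k.+1).
  by rewrite big_ord0 mulr_gt0.
have cv : P (~` A k) @[k --> \oo] --> P (\bigcup_k ~` A k).
  apply: nondecreasing_cvg_mu.
  - by move=> k; exact: measurableC.
  - by apply: bigcup_measurable => k _; exact: measurableC.
  - move=> i j ij; apply/subsetPset; apply: subsetC => x H l li.
    by apply: H; exact: leq_trans ij.
have cv2 : ((e ^+ 2)%:E * P (~` A k))%E @[k --> \oo] --> ((e ^+ 2)%:E * P (\bigcup_k ~` A k))%E.
  exact: cvgeZl.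
rewrite -(cvg_lim _ cv2)//; apply: lime_le; first exact: cvgP cv2.
exact: nearW.
Qed.

End Window.
End Maximal.

Let sq_int_ge0 (X : nat -> T -> R) t :
  (0 <= (\int[P]_x ((X t x) ^+ 2)%:E) * ((t.+1%:R ^+ 2)^-1)%:E)%E.
Proof.
rewrite mule_ge0 ?lee_fin ?invr_ge0 ?sqr_ge0//.
by apply: integral_ge0 => x _; rewrite lee_fin sqr_ge0.
Qed.

(** * The one-sided strong law *)

Section Law.
Context (C : nat -> set (set T)) (M : nat -> T -> R).
Hypothesis mC : forall t, C t `<=` measurable.
Hypothesis M2 : L2_summable P M.
Hypothesis adaptedM : forall s t, (s < t)%N -> G_measurable <<s C t >> (M s).
Hypothesis M0 : forall t A, <<s C t >> A -> \int[P]_(x in A) M t x <= 0.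

Let good e m := [set x | forall k, \sum_(s < k) M (m + s)%N x < e * (m + k).+1%:R].

(** The exceptional set lies in the complement of every [good e m], so [e^2] times its probability
    is below all tails of a convergent series. *)
Let ae_good e : 0 < e -> {ae P, forall x, exists m, good e m x}.
Proof.
move=> e0; exists (\bigcap_m ~` good e m).
have mgood m : measurable (~` good e m).
  apply: measurableC.
  rewrite (_ : good e m = \bigcap_k ((fun x => \sum_(s < k) M (m + s)%N x) @^-1`
      `]-oo, e * (m + k).+1%:R[%classic)); last first.
    apply/seteqP; split=> x H k; first by move=> _; rewrite /= in_itv/=; exact: H.
    by have := H k Logic.I; rewrite /= in_itv.
  apply: bigcap_measurableType => k _; rewrite -[X in measurable X]setTI.
  by apply: measurable_sum => // i; exact: M2.1.
split.
- exact: bigcap_measurableType.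
- apply/eqP; rewrite eq_le measure_ge0 andbT.
  have cv := nneseries_tail_cvg M2.2 (fun k _ => sq_int_ge0 M k).
  suff : ((e ^+ 2)%:E * P (\bigcap_m ~` good e m) <= 0)%E.
    by rewrite pmule_rle0// lte_fin exprn_gt0.
  rewrite -(cvg_lim _ cv)//; apply: lime_ge; first exact: cvgP cv.
  apply: nearW => m; apply: le_trans (drift_maximal_inequality (@mC) M2 adaptedM (@M0) m e0).
  rewrite lee_wpmul2l ?lee_fin ?sqr_ge0// le_measure ?inE//.
  - exact: bigcap_measurableType.
  - exact: mgood.
  - by move=> x; apply.
- by move=> x /= H m _ Hg; apply: H; exists m.
Qed.

(** The countably many levels [1/(j+1)] suffice to reach every [e]. On [good], the sum from [m] on
    stays below about half of [e * n], and the fixed initial sum is absorbed by the other half. *)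
Lemma strong_law_le : {ae P, forall x, forall e, 0 < e ->
  \forall n \near \oo, \sum_(s < n) M s x <= e * n%:R}.
Proof.
have : {ae P, forall x, forall j : nat, exists m, good (j.+1%:R^-1) m x}.
  by apply: ae_foralln => j; exact: ae_good.
apply: filterS => x H e e0.
have [j je] : exists j : nat, j.+1%:R^-1 <= e / 2.
  exists (Num.truncn (e / 2)^-1); rewrite invf_ple ?posrE ?divr_gt0//.
  exact: ltW (truncnS_gt _).
have [m Hm] := H j; pose c := \sum_(s < m) M s x.
(* Large enough for [m <= n] and for [2 * c / e + 1 < n], the latter giving
   [c + e / 2 * (n + 1) <= e * n]. *)
exists (m + Num.truncn (2 * c / e + 1)).+1 => // n /= nm.
have mn : (m <= n)%N by rewrite (leq_trans _ nm)// ltnW// ltnS leq_addr.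
have cn : 2 * c / e + 1 < n%:R.
  apply: lt_le_trans (truncnS_gt _) _; rewrite ler_nat (leq_trans _ nm)// ltnS leq_addl//.
have := Hm (n - m)%N; rewrite subnKC// => Hn.
have -> : \sum_(s < n) M s x = c + \sum_(s < n - m) M (m + s)%N x.
  rewrite /c -!(big_mkord xpredT (fun s => M s x)) (big_cat_nat (leq0n m) mn)//=.
  congr (_ + _); rewrite -{1}[m]add0n big_addn big_mkord.
  by apply: eq_bigr => i _; rewrite addnC.
have h1 : j.+1%:R^-1 * n.+1%:R <= e / 2 * n.+1%:R by rewrite ler_wpM2r.
move: cn; rewrite -ltrBrDr ltr_pdivrMr// => cn.
rewrite -[n.+1%:R]natr1 in h1 Hn.
move: cn h1 Hn; set z := n%:R; set y := \sum_(_ < _) _; set r := j.+1%:R^-1.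
by move=> cn h1 Hn; nra.
Qed.

End Law.

(** * Closure properties of square summability *)

Lemma L2_summable_le (c : R) (X Y : nat -> T -> R) : 0 <= c ->
  (forall t, measurable_fun setT (X t)) ->
  (forall t, (\int[P]_x ((X t x) ^+ 2)%:E <= c%:E * \int[P]_x ((Y t x) ^+ 2)%:E)%E) ->
  L2_summable P Y -> L2_summable P X.
Proof.
move=> c0 mX XY [mY Yoo]; split => //.
apply: (@le_lt_trans _ _ (\sum_(0 <= t <oo)
    (c%:E * ((\int[P]_x ((Y t x) ^+ 2)%:E) * ((t.+1%:R ^+ 2)^-1)%:E)))%E).
  apply: lee_nneseries => [t _ _|t _]; first exact: sq_int_ge0.
  by rewrite muleA lee_wpmul2r// lee_fin invr_ge0 sqr_ge0.
by rewrite nneseriesZl ?lte_mul_pinfty// => t _; exact: sq_int_ge0.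
Qed.

Lemma L2_summableZ (c : R) (X : nat -> T -> R) : L2_summable P X ->
  L2_summable P (fun t x => c * X t x).
Proof.
move=> X2; apply: (L2_summable_le (sqr_ge0 c) _ _ X2) => t.
  by apply: measurable_funM => //; exact: X2.1.
rewrite -ge0_integralZl//.
- by apply: ge0_le_integral => //;
    try (apply/measurable_EFinP; repeat apply: measurable_funM => //;
         try apply: measurable_funX; try apply: measurable_funM => //; exact: X2.1);
    move=> x _; rewrite ?mule_ge0 -?EFinM ?lee_fin ?sqr_ge0 ?exprMn.
- by apply/measurable_EFinP; apply: measurable_funX; exact: X2.1.
- by move=> x _; rewrite lee_fin sqr_ge0.
- by rewrite lee_fin sqr_ge0.
Qed.

(** Rests on [(X + Y)^2 <= 2 X^2 + 2 Y^2], the gap being [(X - Y)^2]. *)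
Lemma L2_summableD (X Y : nat -> T -> R) : L2_summable P X -> L2_summable P Y ->
  L2_summable P (fun t x => X t x + Y t x).
Proof.
move=> X2 Y2.
have mX t : measurable_fun setT (fun x => (2 * X t x ^+ 2)%:E).
  by apply/measurable_EFinP; apply: measurable_funM => //; apply: measurable_funX; exact: X2.1.
have mY t : measurable_fun setT (fun x => (2 * Y t x ^+ 2)%:E).
  by apply/measurable_EFinP; apply: measurable_funM => //; apply: measurable_funX; exact: Y2.1.
have mXY t : measurable_fun setT (fun x => X t x + Y t x).
  by apply: measurable_funD; [exact: X2.1|exact: Y2.1].
split => //.
have E (Z : nat -> T -> R) t : L2_summable P Z ->
    (\int[P]_x ((2 * Z t x ^+ 2)%:E) = 2%:E * \int[P]_x ((Z t x) ^+ 2)%:E)%E.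
  move=> Z2; under eq_integral do rewrite EFinM.
  rewrite ge0_integralZl// => [|x _]; last by rewrite lee_fin sqr_ge0.
  by apply/measurable_EFinP; apply: measurable_funX; exact: Z2.1.
apply: (@le_lt_trans _ _ (\sum_(0 <= t <oo)
    (2%:E * ((\int[P]_x ((X t x) ^+ 2)%:E) * ((t.+1%:R ^+ 2)^-1)%:E)
   + 2%:E * ((\int[P]_x ((Y t x) ^+ 2)%:E) * ((t.+1%:R ^+ 2)^-1)%:E)))%E).
  apply: lee_nneseries => [t _ _|t _]; first exact: (sq_int_ge0 (fun t x => X t x + Y t x)).
  rewrite !muleA -!E// -ge0_muleDl; last 2 first.
  - by apply: integral_ge0 => x _; rewrite lee_fin mulr_ge0// sqr_ge0.
  - by apply: integral_ge0 => x _; rewrite lee_fin mulr_ge0// sqr_ge0.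
  rewrite lee_wpmul2r ?lee_fin ?invr_ge0 ?sqr_ge0//.
  rewrite -ge0_integralD//; last 2 first.
  - by move=> x _; rewrite lee_fin mulr_ge0// sqr_ge0.
  - by move=> x _; rewrite lee_fin mulr_ge0// sqr_ge0.
  apply: ge0_le_integral => //.
  - by move=> x _; rewrite lee_fin sqr_ge0.
  - by apply/measurable_EFinP; exact: measurable_funX.
  - exact: emeasurable_funD.
  - move=> x _; rewrite -EFinD lee_fin -subr_ge0.
    have -> : 2 * X t x ^+ 2 + 2 * Y t x ^+ 2 - (X t x + Y t x) ^+ 2 =
      (X t x - Y t x) ^+ 2 by ring.
    exact: sqr_ge0.
rewrite nneseriesD; last 2 first.
- by move=> t _ _; rewrite mule_ge0.
- by move=> t _ _; rewrite mule_ge0.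
rewrite !nneseriesZl//; first by rewrite lte_add_pinfty// lte_mul_pinfty// ?X2.2 ?Y2.2.
Qed.

Lemma L2_summable_cst (c : R) : L2_summable P (fun _ => cst c).
Proof.
split=> //.
apply: (@le_lt_trans _ _ ((c ^+ 2 * 2)%:E)); last by rewrite ltry.
apply: lime_le.
  by apply: is_cvg_nneseries => n _ _; exact: (sq_int_ge0 (fun _ => cst c)).
apply: nearW => n; rewrite big_mkord.
have Ec : (\int[P]_x ((cst c x) ^+ 2)%:E = (c ^+ 2)%:E)%E.
  transitivity (\int[P]_x (cst (c ^+ 2)%:E x))%E; first by [].
  by rewrite integral_cst// [X in (_ * X)%E](probability_setT P) mule1.
under eq_bigr do rewrite Ec -EFinM.
rewrite sumEFin lee_fin -mulr_sumr ler_wpM2l ?sqr_ge0//.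
(* Strengthened for induction through [1/(n+1)^2 <= 1/n - 1/(n+1)]. As [0^-1 = 0], the case [n = 0]
   holds, but the step from 0 to 1 is done apart. *)
suff : \sum_(i < n) (i.+1%:R ^+ 2)^-1 <= 2 - n%:R^-1 :> R.
  by move=> /le_trans; apply; rewrite gerBl invr_ge0.
elim: n => [|n IH]; first by rewrite big_ord0 invr0 subr0.
case: n IH => [_|n IH]; first by rewrite big_ord1 expr1n invr1; lra.
rewrite big_ord_recr/=; apply: le_trans (lerD IH (lexx _)) _.
have n0 : 0 < n.+1%:R :> R by [].
rewrite -[n.+2%:R]natr1; set z : R := n.+1%:R in n0 *.
rewrite -subr_ge0.
have -> : 2 - (z + 1)^-1 - (2 - z^-1 + ((z + 1) ^+ 2)^-1) = (z * (z + 1) ^+ 2)^-1.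
  by field; rewrite !gt_eqF// addr_gt0.
by rewrite invr_ge0 mulr_ge0 ?sqr_ge0// ltW.
Qed.

Lemma L2_summable_sum (I : Type) (r : seq I) (X : I -> nat -> T -> R) :
  (forall i, L2_summable P (X i)) ->
  L2_summable P (fun t x => \sum_(i <- r) X i t x).
Proof.
move=> X2; elim: r => [|i r IH].
  rewrite (_ : (fun _ => _) = (fun _ => cst 0)); first exact: L2_summable_cst.
  by apply/funext => t; apply/funext => x; rewrite big_nil.
rewrite (_ : (fun _ => _) = (fun t x => X i t x + \sum_(i <- r) X i t x)).
  exact: L2_summableD.
by apply/funext => t; apply/funext => x; rewrite big_cons.
Qed.

(** Converts the form of (i) and (iii): the term [t = 0] is finite by itself, and
    [1/(t+1)^2 <= 1/t^2] afterwards. *)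
Lemma L2_summable_shift (X : nat -> T -> R) :
  (forall t, measurable_fun setT (X t)) ->
  (forall t, (\int[P]_x ((X t x) ^+ 2)%:E < +oo)%E) ->
  (\sum_(1 <= t <oo)
     ((\int[P]_x ((X t x) ^+ 2)%:E) * ((t%:R ^+ 2)^-1)%:E) < +oo)%E ->
  L2_summable P X.
Proof.
move=> mX X2 Xoo; split=> //.
have I0 t : (0 <= \int[P]_x ((X t x) ^+ 2)%:E)%E.
  by apply: integral_ge0 => x _; rewrite lee_fin sqr_ge0.
rewrite nneseries_recl//.
rewrite lte_add_pinfty//; first by rewrite expr1n invr1 mule1.
apply: le_lt_trans Xoo.
rewrite -!(nneseries_addn 1); last 2 first.
- by move=> t; rewrite mule_ge0// lee_fin invr_ge0 sqr_ge0.
- by move=> t; exact: sq_int_ge0.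
apply: lee_nneseries => [t _ _|t _]; first exact: sq_int_ge0.
rewrite lee_wpmul2l// lee_fin lef_pV2 ?posrE ?exprn_gt0 ?ltr0n ?addn1//.
by rewrite lerXn2r ?nnegrE// ler_nat.
Qed.

End StrongLaw.

(** * Pathwise passage from sums to upper limits *)

Section LimSup.
Context (R : realType).

Lemma limn_esup_le_near (u : nat -> \bar R) (l : \bar R) :
  (\forall n \near \oo, (u n <= l)%E) -> (limn_esup u <= l)%E.
Proof.
move=> ul; apply: (@le_trans _ _ (ereal_sup (u @` [set n | (u n <= l)%E]))).
  by apply: ereal_inf_lbound; exists [set n | (u n <= l)%E].
by apply: ub_ereal_sup => _ [n /= un <-].
Qed.

Lemma limn_esup_lt_near (u : nat -> \bar R) (l : \bar R) :
  (limn_esup u < l)%E -> \forall n \near \oo, (u n <= l)%E.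
Proof.
move=> /ereal_inf_lt[_ [A FA <-] supA]; apply: filterS FA => n An.
by apply: (le_trans _ (ltW supA)); apply: ereal_sup_ubound; exists n.
Qed.

Lemma lyap_ge0 (K : nat) (w q : 'I_K -> R) : (forall k, 0 < w k) -> 0 <= lyap w q.
Proof.
move=> w0; rewrite mulr_ge0 ?invr_ge0//; apply: sumr_ge0 => k _.
by rewrite mulr_ge0 ?sqr_ge0// ltW.
Qed.

(* The drifts telescope to [lyap (q n) - lyap (q 0) >= - lyap (q 0)]. *)
Lemma penalty_sum_le (K : nat) (w : 'I_K -> R) (q : nat -> 'I_K -> R) (b : nat -> R) :
  (forall k, 0 < w k) ->
  (forall e, 0 < e -> \forall n \near \oo,
    \sum_(s < n) (lyap w (q s.+1) - lyap w (q s) + b s) <= e * n%:R) ->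
  forall e, 0 < e -> \forall n \near \oo, \sum_(s < n) b s <= e * n%:R.
Proof.
move=> w0 H e e0; have e20 : 0 < e / 2 by rewrite divr_gt0.
have H1 : \forall n \near \oo, lyap w (q 0) / (e / 2) <= n%:R.
  exact: nbhs_infty_ger.
apply: filterS2 (H _ e20) H1 => n; rewrite ler_pdivrMr// big_split/=.
rewrite -(big_mkord xpredT (fun s => lyap w (q s.+1) - lyap w (q s))) telescope_sumr//.
have := lyap_ge0 (q n) w0.
set S := \sum_(_ < n) _; set z : R := n%:R; lra.
Qed.

(** The nonnegative sum of [y] is dropped; the slack [e * V] becomes [e] after division by
    [V * n]. *)
Lemma limn_esup_penalty_le (V B c : R) (p : nat -> R) (y : nat -> R) :
  0 < V -> (forall s, 0 <= y s) ->
  (forall e, 0 < e -> \forall n \near \oo,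
    \sum_(s < n) (V * p s + (y s - (B + V * c))) <= e * n%:R) ->
  (limn_esup (fun n => (tavg p n)%:E) <= (c + B / V)%:E)%E.
Proof.
move=> V0 y0 H; apply/lee_addgt0Pr => e e0; apply: limn_esup_le_near.
have := H (e * V) (mulr_gt0 e0 V0); apply: filterS2 (nbhs_infty_gt 0) => n n0.
rewrite big_split/= sumrB sumr_const card_ord -mulr_sumr -[(B + V * c) *+ n]mulr_natr.
have : 0 <= \sum_(s < n) y s by apply: sumr_ge0.
rewrite /tavg -EFinD lee_fin; have z0 : 0 < n%:R :> R by rewrite ltr0n.
set Y := \sum_(_ < n) y _; set S := \sum_(_ < n) p _ => Y0 h.
rewrite mulrC ler_pdivrMr// -(ler_pM2l V0).
have -> : V * ((c + B / V + e) * n%:R) = (B + V * c) * n%:R + e * V * n%:R.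
  by field; rewrite gt_eqF.
by lra.
Qed.

(** Division by [eps * n] gives the bound for each large [n]; the remaining care concerns an upper
    limit on the right that may be infinite. *)
Lemma limn_esup_backlog_le (V eps B c : R) (p : nat -> R) (y : nat -> R) :
  0 <= V -> 0 < eps ->
  (forall e, 0 < e -> \forall n \near \oo,
    \sum_(s < n) (V * p s + (eps * y s - (B + V * c))) <= e * n%:R) ->
  (limn_esup (fun n => (tavg y n)%:E) <= (B / eps)%:E +
    (V / eps)%:E * limn_esup (fun n => (tavg (fun s => c - p s) n)%:E))%E.
Proof.
move=> V0 eps0 H.
have H' e : 0 < e -> \forall n \near \oo,
    tavg y n <= B / eps + V / eps * tavg (fun s => c - p s) n + e.
  move=> e0; have := H (e * eps) (mulr_gt0 e0 eps0).
  apply: filterS2 (nbhs_infty_gt 0) => n n0.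
  have z0 : 0 < n%:R :> R by rewrite ltr0n.
  rewrite /tavg big_split/= !sumrB !sumr_const !card_ord -!mulr_sumr.
  rewrite -[(B + V * c) *+ n]mulr_natr -[c *+ n]mulr_natr.
  set Y := \sum_(_ < n) y _; set S := \sum_(_ < n) p _ => h.
  rewrite mulrC ler_pdivrMr// -(ler_pM2l eps0).
  have -> : eps * ((B / eps + V / eps * (n%:R^-1 * (c * n%:R - S)) + e) * n%:R) =
      (B + V * c) * n%:R - V * S + e * eps * n%:R.
    by field; rewrite !gt_eqF.
  by lra.
move: V0; rewrite le_eqVlt => /predU1P[V0|V0].
  (* With [V = 0] the product with the upper limit is 0, even when that limit is infinite. *)
  rewrite -V0 mul0r mul0e adde0; apply/lee_addgt0Pr => e e0.
  apply: limn_esup_le_near; apply: filterS (H' e e0) => n.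
  by rewrite -V0 mul0r mul0r addr0 -EFinD lee_fin.
set L := limn_esup (fun n => (tavg (fun s => c - p s) n)%:E).
have v0 : 0 < V / eps by rewrite divr_gt0.
have key (r : R) : (L < r%:E)%E ->
    (limn_esup (fun n => (tavg y n)%:E) <= (B / eps + V / eps * r)%:E)%E.
  move=> Lr; apply/lee_addgt0Pr => e e0; apply: limn_esup_le_near.
  apply: filterS2 (limn_esup_lt_near Lr) (H' e e0) => n /=; rewrite lee_fin => hr hn.
  by rewrite -EFinD lee_fin (le_trans hn)// lerD2r lerD2l ler_wpM2l// ltW.
case: L key => [l| |] key.
- rewrite -EFinM -EFinD; apply/lee_addgt0Pr => e e0.
  (* The excess over [l] is chosen so that multiplication by [V / eps] turns it into [e]. *)
  have := key (l + e / (V / eps)); rewrite lte_fin ltrDl divr_gt0// => /(_ isT).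
  by rewrite mulrDr mulrC [X in _ + (_ + X)]mulrC divfK ?gt_eqF// addrA mulrC EFinD.
- by rewrite gt0_muley ?lte_fin// addey// leey.
- rewrite gt0_muleNy ?lte_fin// addeNy leeNy_eq; apply/eqP.
  (* This argument makes the bound in [key] equal to the arbitrary real [r]. *)
  apply: eq_ninfty => r; have := key ((r - B / eps) / (V / eps)) (ltNyr _).
  by rewrite [V / eps * _]mulrC divfK ?gt_eqF// addrC subrK.
Qed.
End LimSup.

(** * Second moments of the Lyapunov drift from the fourth-moment condition *)

Section Adapted.
Context (d : measure_display) (T : measurableType d) (R : realType).

Lemma sigma_gen_measurable (fs : set (T -> R)) f : fs f -> G_measurable (sigma_gen fs) f.
Proof.
by move=> fsf B mB; apply: sub_sigma_algebra; exists f, B.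
Qed.

Lemma sigma_gen_generator_sub (fs : set (T -> R)) :
  (forall f, fs f -> measurable_fun setT f) ->
  [set A : set T | exists f, exists B : set R,
     [/\ fs f, measurable B & A = f @^-1` B]] `<=` measurable.
Proof. by move=> mfs _ [f [B [/mfs mf mB ->]]]; rewrite -[X in measurable X]setTI; exact: mf. Qed.

End Adapted.

Section Increments.
Context (d : measure_display) (T : measurableType d) (R : realType).
Context (P : probability T R) (fs : set (T -> R)).
Hypothesis mfs : forall f, fs f -> measurable_fun setT f.

Lemma quartic_integral_mul_le (q q' : T -> R) (D : R) : fs q ->
  measurable_fun setT q' -> 0 <= D ->
  (exists Y, cond_exp_version P (sigma_gen fs) (fun x => (q' x - q x) ^+ 4) Y /\
     {ae P, forall x, Y x <= D}) ->
  forall f : T -> R, G_measurable (sigma_gen fs) f -> (forall x, 0 <= f x) ->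
  (\int[P]_x (f x * (q' x - q x) ^+ 4)%:E <= D%:E * \int[P]_x (f x)%:E)%E.
Proof.
move=> fsq mq' D0 [Y [XY YD]] f mf f0.
have mC := sigma_gen_generator_sub mfs.
apply: (ge0_integral_mul_le mC) => //.
- by apply: measurable_funX; apply: measurable_funB => //; exact: mfs.
- by move=> x; rewrite (exprM _ 2 2) sqr_ge0.
- by move=> A CA; apply: (cond_exp_version_le mC D0 XY YD).
Qed.

End Increments.

Section L2Increments.
Context (d : measure_display) (T : measurableType d) (R : realType).
Context (P : probability T R) (K : nat) (Q : nat -> 'I_K -> T -> R) (D : R).
Hypothesis mQ : forall t k, measurable_fun setT (Q t k).
Hypothesis D0 : 0 <= D.
Hypothesis incr4 : forall t k, exists Y : T -> R,
     cond_exp_version P (Qsigma Q t) (fun x => (Q t.+1 k x - Q t k x) ^+ 4) Y /\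
     {ae P, forall x, Y x <= D}.

Let mfs t f : [set f | exists k, f = Q t k] f -> measurable_fun setT f.
Proof. by move=> [k ->]. Qed.

Let mdQ t k : measurable_fun setT (fun x => Q t.+1 k x - Q t k x).
Proof. exact: measurable_funB. Qed.

(** Weight 1 in (ii) bounds the fourth moment of the increment by [D], so comparison with a constant
    sequence applies. *)
Lemma L2_summable_sqr_increment k :
  L2_summable P (fun t x => (Q t.+1 k x - Q t k x) ^+ 2).
Proof.
apply: (L2_summable_le D0 _ _ (L2_summable_cst P 1)) => t.
  exact: measurable_funX.
have H := quartic_integral_mul_le (@mfs t) (q := Q t k) _ (mQ t.+1 k) D0 (incr4 t k).
have := H _ (cst 1); rewrite /= expr1n.
under eq_integral do rewrite mul1r (exprM _ 2 2).
apply => //; first by exists k.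
by apply/G_measurableP; exact: measurable_cst.
Qed.

(* [dQ^2 <= 1 + dQ^4], so [Q^2 dQ^2] is controlled by (ii) weighted with [Q^2]. *)
Lemma L2_summable_mul_increment k : L2_summable P (Q^~ k) ->
  L2_summable P (fun t x => Q t k x * (Q t.+1 k x - Q t k x)).
Proof.
move=> Q2; have D10 : 0 <= 1 + D by rewrite addr_ge0.
apply: (L2_summable_le D10 _ _ Q2) => t; first exact: measurable_funM.
have H := quartic_integral_mul_le (@mfs t) (q := Q t k) _ (mQ t.+1 k) D0 (incr4 t k).
have {}H := H _ (fun x => Q t k x ^+ 2).
have mQ2 : measurable_fun setT (fun x => Q t k x ^+ 2) by exact: measurable_funX.
have m4 : measurable_fun setT (fun x => Q t k x ^+ 2 * (Q t.+1 k x - Q t k x) ^+ 4).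
  by apply: measurable_funM => //; exact: measurable_funX.
have p4 x : 0 <= (Q t.+1 k x - Q t k x) ^+ 4 by rewrite (exprM _ 2 2) sqr_ge0.
apply: (@le_trans _ _ (\int[P]_x ((Q t k x ^+ 2)%:E +
    (Q t k x ^+ 2 * (Q t.+1 k x - Q t k x) ^+ 4)%:E))%E).
  apply: ge0_le_integral => //.
  - by move=> x _; rewrite lee_fin sqr_ge0.
  - by apply/measurable_EFinP; apply: measurable_funX; exact: measurable_funM.
  - by apply: emeasurable_funD; exact/measurable_EFinP.
  move=> x _; rewrite -EFinD lee_fin -subr_ge0.
  set a := Q t k x; set u := _ - a.
  have -> : a ^+ 2 + a ^+ 2 * u ^+ 4 - (a * u) ^+ 2 =
      a ^+ 2 * (u ^+ 2 * u ^+ 2 - u ^+ 2 + 1) by ring.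
  rewrite mulr_ge0 ?sqr_ge0//.
  (* With [z = u^2], the factor is [z^2 - z + 1 = (z - 1)^2 + z]. *)
  by move: (sqr_ge0 u) (sqr_ge0 (u ^+ 2 - 1)); set z := u ^+ 2 => z0 z1; nra.
rewrite ge0_integralD//; first last.
- exact/measurable_EFinP.
- by move=> x _; rewrite lee_fin mulr_ge0 ?sqr_ge0.
- exact/measurable_EFinP.
- by move=> x _; rewrite lee_fin sqr_ge0.
rewrite EFinD ge0_muleDl ?lee_fin// mul1e leeD2l//.
apply: H => //; first by exists k.
- apply/G_measurableP; apply: measurable_funX; apply/G_measurableP.
  by apply: sigma_gen_measurable; exists k.
- by move=> x; exact: sqr_ge0.
Qed.

(** Writing [dQ] for the increment, half the difference of squares is [Q dQ + dQ^2 / 2], and both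
    terms are square-summable. *)
Lemma L2_summable_lyap_drift (w : 'I_K -> R) : (forall k, L2_summable P (Q^~ k)) ->
  L2_summable P (fun t x => lyap w (Q t.+1 ^~ x) - lyap w (Q t ^~ x)).
Proof.
move=> Q2.
rewrite (_ : (fun _ => _) = fun t x => \sum_k (w k * (Q t k x * (Q t.+1 k x - Q t k x)) +
    2^-1 * w k * (Q t.+1 k x - Q t k x) ^+ 2)).
  apply: L2_summable_sum => k; apply: L2_summableD; apply: L2_summableZ.
    exact: L2_summable_mul_increment.
  exact: L2_summable_sqr_increment.
apply/funext => t; apply/funext => x.
rewrite /lyap -mulrBr -sumrB mulr_sumr; by apply: eq_bigr => k _; field.
Qed.

End L2Increments.

(** * The drift-plus-penalty process and the two conclusions *)

Theorem theorem6 (d : measure_display) (T : measurableType d) (R : realType)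
  (P : probability T R) (K : nat)
  (Q : nat -> 'I_K -> T -> R) (p : nat -> T -> R)
  (w : 'I_K -> R) (D B pstar V eps : R)
  (mQ : forall t k, measurable_fun setT (Q t k))
  (mp : forall t, measurable_fun setT (p t))
  (w_pos : forall k, 0 < w k)
  (* (i) *)
  (p2_fin : forall t, (\int[P]_x ((p t x) ^+ 2)%:E < +oo)%E)
  (p2_sum : (\sum_(1 <= tau <oo)
               ((\int[P]_x ((p tau x) ^+ 2)%:E) * ((tau%:R ^+ 2)^-1)%:E) < +oo)%E)
  (* (ii) *)
  (D_pos : 0 < D)
  (incr4 : forall t k, exists Y : T -> R,
     cond_exp_version P (Qsigma Q t) (fun x => (Q t.+1 k x - Q t k x) ^+ 4) Y /\
     {ae P, forall x, Y x <= D})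
  (* (iii) *)
  (Q2_fin : forall t k, (\int[P]_x ((Q t k x) ^+ 2)%:E < +oo)%E)
  (Q2_sum : forall k, (\sum_(1 <= t <oo)
               ((\int[P]_x ((Q t k x) ^+ 2)%:E) * ((t%:R ^+ 2)^-1)%:E) < +oo)%E)
  (* (iv) *)
  (V_ge0 : 0 <= V) (eps_ge0 : 0 <= eps)
  (drift : forall t, exists Ydelta Yp : T -> R,
     [/\ cond_exp_version P (Hsigma Q p t)
           (fun x => lyap w (Q t.+1 ^~ x) - lyap w (Q t ^~ x)) Ydelta,
         cond_exp_version P (Hsigma Q p t) (p t) Yp &
         {ae P, forall x, Ydelta x + V * Yp x <=
                          B + V * pstar - eps * \sum_(k < K) `|Q t k x|}]) :
  (* (a) *)
  (0 < V -> {ae P, forall x,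
     (limn_esup (fun t => (tavg (p ^~ x) t)%:E) <= (pstar + B / V)%:E)%E}) /\
  (* (b) *)
  (0 < eps -> {ae P, forall x,
     (limn_esup (fun t => (tavg (fun tau => \sum_(k < K) `|Q tau k x|) t)%:E) <=
      (B / eps)%:E +
      (V / eps)%:E * limn_esup (fun t => (tavg (fun tau => pstar - p tau x) t)%:E))%E}).
Proof.
pose pen t x := V * p t x + (eps * \sum_(k < K) `|Q t k x| - (B + V * pstar)).
pose M t x := lyap w (Q t.+1 ^~ x) - lyap w (Q t ^~ x) + pen t x.
pose fs t := [set f | (exists k s, (s <= t)%N /\ f = Q s k) \/
                      (exists s, (s < t)%N /\ f = p s)].
(* The generator of [Hsigma Q p t], spelled out so that [<<s C t>>] is that sigma-algebra by
   unfolding. *)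
pose C t := [set A : set T | exists f, exists B : set R,
     [/\ fs t f, measurable B & A = f @^-1` B]].
have mfs t f : fs t f -> measurable_fun setT f by case=> [[k [s [_ ->]]]|[s [_ ->]]].
have mC t : C t `<=` measurable := sigma_gen_generator_sub (@mfs t).
have Q2 k : L2_summable P (Q^~ k) by apply: L2_summable_shift.
have p2 : L2_summable P p by apply: L2_summable_shift.
have drift2 := L2_summable_lyap_drift mQ (ltW D_pos) incr4 w Q2.
have rest2 : L2_summable P (fun t x => eps * \sum_(k < K) `|Q t k x| - (B + V * pstar)).
  apply: L2_summableD; last exact: L2_summable_cst.
  apply: L2_summableZ; apply: L2_summable_sum => k.
  apply: (L2_summable_le ler01 _ _ (Q2 k)) => t.
    exact: measurableT_comp.
  by rewrite mul1e; under eq_integral do rewrite real_normK ?num_real//.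
have Vp2 : L2_summable P (fun t x => V * p t x) by exact: L2_summableZ.
have M2 : L2_summable P M by apply: L2_summableD => //; exact: L2_summableD.
(* [M s] involves [Q] up to time [s + 1] and [p s]; both belong to the history at [t] exactly
   because [s < t]. *)
have adaptedM s t : (s < t)%N -> G_measurable <<s C t >> (M s).
  move=> st.
  have GQ u k : (u <= t)%N -> measurable_fun [set: g_sigma_algebraType (C t)] (Q u k).
    by move=> ut; apply/G_measurableP; apply: sigma_gen_measurable; left; exists k, u.
  have Gp : measurable_fun [set: g_sigma_algebraType (C t)] (p s).
    by apply/G_measurableP; apply: sigma_gen_measurable; right; exists s.
  have Glyap u : (u <= t)%N ->
      measurable_fun [set: g_sigma_algebraType (C t)] (fun x => lyap w (Q u ^~ x)).
    move=> ut; apply: measurable_funM => //; apply: measurable_sum => k.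
    by apply: measurable_funM => //; apply: measurable_funX; exact: GQ.
  apply/G_measurableP; apply: measurable_funD.
    by apply: measurable_funB; apply: Glyap => //; exact: ltnW.
  apply: measurable_funD; first exact: measurable_funM.
  apply: measurable_funB => //; apply: measurable_funM => //.
  apply: measurable_sum => k; apply: measurableT_comp => //.
  by apply: GQ; exact: ltnW.
have M0 t A : <<s C t >> A -> \int[P]_(x in A) M t x <= 0.
  move=> CA; have mA := sub_sigma (@mC t) CA.
  have [Yd [Yp [Ed Ep Yle]]] := drift t.
  have id := L2_summable_integrable t drift2.
  have ip := L2_summable_integrable t p2.
  have ir := L2_summable_integrable t rest2.
  have iYd := cond_exp_version_integrable (@mC t) id Ed.
  have iYp := cond_exp_version_integrable (@mC t) ip Ep.
  have toA f : P.-integrable setT (EFin \o f) -> P.-integrable A (EFin \o f).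
    exact: integrableS.
  have iVZ f : P.-integrable setT (EFin \o f) ->
      P.-integrable setT (EFin \o (fun x => V * f x)).
    by move=> h; exact: (@integrableZl _ _ _ P setT measurableT V _ h).
  have iD f g : P.-integrable setT (EFin \o f) -> P.-integrable setT (EFin \o g) ->
      P.-integrable setT (EFin \o (fun x => f x + g x)).
    by move=> h h'; exact: (@integrableD _ _ _ P setT measurableT _ _ h h').
  set rest := (fun x => eps * \sum_(k < K) `|Q t k x| - (B + V * pstar)) in ir.
  have split f g : P.-integrable setT (EFin \o f) -> P.-integrable setT (EFin \o g) ->
      \int[P]_(x in A) (f x + (V * g x + rest x)) =
      \int[P]_(x in A) f x + (V * \int[P]_(x in A) g x + \int[P]_(x in A) rest x).
    move=> h h'; rewrite (RintegralD mA (toA _ h) (toA _ (iD _ _ (iVZ _ h') ir))).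
    by rewrite (RintegralD mA (toA _ (iVZ _ h')) (toA _ ir)) (RintegralZl _ mA (toA _ h')).
  (* Over [A] in the history, the drift and [p t] may be replaced by their conditional versions;
     (iv) then makes the integrand a.e. nonpositive, which is the bound with constant 0. *)
  have -> : \int[P]_(x in A) M t x =
      \int[P]_(x in A) (Yd x + (V * Yp x + rest x)).
    rewrite split// [LHS]split//; congr (_ + (_ * _ + _)).
      by rewrite /Rintegral Ed.2.
    by rewrite /Rintegral Ep.2.
  have iY := iD _ _ iYd (iD _ _ (iVZ _ iYp) ir).
  rewrite -lee_fin fineK; last exact: (integrable_fin_num mA (toA _ iY)).
  rewrite -[leRHS](mul0e (P A)); apply: ae_integral_le_cst => //.
    by apply/measurable_EFinP; exact: measurable_int iY.
  by apply: filterS Yle => x; rewrite /rest; lra.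
have law : {ae P, forall x e, 0 < e ->
    \forall n \near \oo, \sum_(s < n) pen s x <= e * n%:R}.
  apply: filterS (strong_law_le mC M2 adaptedM M0) => x.
  exact: (penalty_sum_le (q := fun t => Q t ^~ x) (b := pen ^~ x) w_pos).
split=> [V0|eps0]; apply: filterS law => x law.
  apply: (limn_esup_penalty_le V0 (y := fun s => eps * \sum_(k < K) `|Q s k x|)) => // s.
  by rewrite mulr_ge0// sumr_ge0.
exact: limn_esup_backlog_le.
Qed.
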